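(* Let $p>1$. Assume that there exist constants $a>0$, $K_1\ge1$ and $K_2\ge1$ such that $$\mathbb E\big[\exp\big(a(G_{X_1}(X_1))^p\big)\big]\le K_1\quad\text{and}\quad\mathbb E\big[\exp\big(a(G_\varepsilon(\varepsilon))^p\big)\big]\le K_2.$$ Let $q$ be the conjugate exponent of $p$ and let $\tau>0$ be such that $(q\tau)^{1/q}(pa)^{1/p}(1-\rho)=1$. Then, for any $\tau_1>\tau$, there exist positive numbers $t_1,x_1,A,B$, depending only on $a,\rho,K_1,K_2,p$ and $\tau_1$, such that $$\mathbb E[e^{\pm tS_n}]\le\begin{cases}\exp(n\tau_1t^q)&\text{if }t\ge t_1,\\ \exp(nAt^2)&\text{if }t\in[0,t_1],\end{cases}$$ and $$\mathbb P(\pm S_n\ge x)\le\begin{cases}\exp(-a_1x^p/n^{p-1})&\text{if }x\ge nx_1,\\ \exp(-Bx^2/n)&\text{if }x\in[0,nx_1],\end{cases}$$ where $a_1$ is such that $(q\tau_1)^{1/q}(pa_1)^{1/p}=1$.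
   Context: $(\mathcal X,d)$ and $(\mathcal Y,\delta)$ are complete separable metric spaces; $(\varepsilon_i)_{i\ge1}$ is a sequence of iid $\mathcal Y$-valued random variables; $X_1$ is an $\mathcal X$-valued random variable independent of $(\varepsilon_i)_{i\ge2}$. The Markov chain is $X_n=F(X_{n-1},\varepsilon_n)$ for $n\ge2$, where $F:\mathcal X\times\mathcal Y\to\mathcal X$ is measurable and satisfies, for some $\rho\in[0,1)$ and $C>0$, $\mathbb E[d(F(x,\varepsilon_1),F(x',\varepsilon_1))]\le\rho\,d(x,x')$ for all $x,x'\in\mathcal X$, and $d(F(x,y),F(x,y'))\le C\,\delta(y,y')$ for all $x\in\mathcal X$, $y,y'\in\mathcal Y$. $n\ge1$ and $f:\mathcal X^n\to\mathbb R$ are arbitrary with $|f(x_1,\ldots,x_n)-f(x_1',\ldots,x_n')|\le d(x_1,x_1')+\cdots+d(x_n,x_n')$, and $S_n=f(X_1,\ldots,X_n)-\mathbb E[f(X_1,\ldots,X_n)]$. Let $P_{X_1}$ be the law of $X_1$, $P_\varepsilon$ the common law of the $\varepsilon_k$'s, $G_{X_1}(x)=\int d(x,x')P_{X_1}(dx')$, $G_\varepsilon(y)=\int C\,\delta(y,y')P_\varepsilon(dy')$; $G_\varepsilon(\varepsilon)$ denotes a random variable distributed as $G_\varepsilon(\varepsilon_k)$. Statements with $\pm$ hold for each of the two signs. *)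

(* Defs.v *)
From HB Require Import structures.
From mathcomp Require Import all_boot all_order all_algebra.
From mathcomp Require Import all_classical all_reals all_analysis.
Set Implicit Arguments.
Unset Strict Implicit.
Unset Printing Implicit Defensive.
Import Order.TTheory GRing.Theory Num.Theory.
Import numFieldNormedType.Exports.
Local Open Scope classical_set_scope.
Local Open Scope ring_scope.

#[short(type="completeMetricType")]
HB.structure Definition CompleteMetric (R : numDomainType) :=
  {T of Metric R T & Complete T}.

Definition separable (T : topologicalType) : Prop :=
  exists2 D : set T, countable D & dense D.

Notation borel T := (g_sigma_algebraType (@open T)).

Section independence.
Context {d d1 d2 : measure_display} {Omega : measurableType d}
  {T1 : measurableType d1} {T2 : measurableType d2} {R : realType}.
Variable P : probability Omega R.

Definition mutually_independent (I : eqType) (Z : I -> {RV P >-> T2}) : Prop :=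
  forall (s : seq I) (B : I -> set T2), uniq s ->
    (forall i, measurable (B i)) ->
    P (\big[setI/setT]_(i <- s) (Z i @^-1` B i)) =
    (\prod_(i <- s) P (Z i @^-1` B i))%E.

Definition identically_distributed (I : Type) (Z : I -> {RV P >-> T2}) : Prop :=
  forall (i j : I) (B : set T2), measurable B ->
    distribution P (Z i) B = distribution P (Z j) B.

Definition sigma_family (I : Type) (D : set I) (Z : I -> {RV P >-> T2}) :
    set (set Omega) :=
  <<s \bigcup_(i in D) preimage_set_system setT (Z i) measurable >>.

Definition independent_of_family (I : Type) (D : set I)
    (X : {RV P >-> T1}) (Z : I -> {RV P >-> T2}) : Prop :=
  forall (A : set T1) (E : set Omega), measurable A -> sigma_family D Z E ->
    P ((X @^-1` A) `&` E) = (P (X @^-1` A) * P E)%E.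

End independence.

(* Indices start from 0: [eps i] is the innovation of index i + 1 and
   [chain F X1 eps k] is the state of index k + 1 of the chain started at X1,
   so that [eps 0] is not used by the recursion. *)
Fixpoint chain (Omega X Y : Type) (F : X * Y -> X) (X1 : Omega -> X)
    (eps : nat -> Omega -> Y) (k : nat) (w : Omega) : X :=
  if k is k'.+1 then F (chain F X1 eps k' w, eps k w) else X1 w.

(* The distance is scaled by c; the value is an extended real as the law of Z
   is not assumed to have a first moment. *)
Definition mean_dist {d : measure_display} {Omega : measurableType d}
    {R : realType} (P : probability Omega R) (T : completeMetricType R)
    (c : R) (Z : {RV P >-> borel T}) (x : T) : \bar R :=
  (\int[distribution P Z]_(x' in setT) (c * mdist x (x' : T))%:E)%E.

Definition lipschitz1 {R : realType} (T : metricType R) (n : nat)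
    (f : ('I_n -> T) -> R) : Prop :=
  forall x x' : 'I_n -> T, `|f x - f x'| <= \sum_(i < n) mdist (x i) (x' i).

Definition centered {d : measure_display} {Omega : measurableType d}
    {R : realType} (P : probability Omega R) (Z : Omega -> R) (w : Omega) : R :=
  Z w - fine ('E_P[Z])%E.

(* Main.v *)
From HB Require Import structures.
Require Import Defs.
From mathcomp Require Import all_boot all_order all_algebra.
From mathcomp Require Import all_classical all_reals all_analysis.
From mathcomp Require Import measurable_realfun ring lra.
Set Implicit Arguments.
Unset Strict Implicit.
Unset Printing Implicit Defensive.
Import Order.TTheory GRing.Theory Num.Theory.
Import numFieldNormedType.Exports.
Local Open Scope classical_set_scope.
Local Open Scope ring_scope.

(** Write the chain as [x_0 = X1], [x_(k+1) = F (x_k, eps_(k+1))], and let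
    [f_k] be the conditional expectation of [f (x_0, ..., x_n)] given
    [x_0, ..., x_k]: it is obtained from [f_(k+1)] by integrating out the
    innovation [eps_(k+1)]. Contraction in mean shows, by descending induction
    on [k], that [f_k] is 1-Lipschitz in [x_0, ..., x_(k-1)] and Lipschitz with
    constant [c = 1 / (1 - rho)] in [x_k]: one integration turns the constant
    [c] at [x_(k+1)] into [1 + c * rho = c] at [x_k]
    ([integrate_last_lipschitz]).

    Given the past, the martingale increment [f_(k+1) - f_k] is therefore a
    centered function [D] of the single innovation, bounded by [c * G] where [G]
    is the mean distance [mean_dist C (eps 0)] ([mean_dist 1 X1] for the initial
    state). Since [c] equals [(q * tau) `^ q^-1 * (p * a) `^ p^-1], Young's
    inequality reads [t * (c * G) <= tau * t `^ q + a * G `^ p]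
    ([young_exponents]), so the exponential moment of [G] yields
    [E expR (t * D) <= K * expR (tau * t `^ q)]. For large [t] the factor [K] is
    absorbed by passing from [tau] to [tau1]; for bounded [t], expanding to
    second order and using [E D = 0] gives [expR (A * t ^+ 2)].

    Multiplying these bounds along the chain ([laplace_chain]) gives the
    estimates on the Laplace transform, and Chernoff's inequality gives the
    tails: for large [x] the optimal [t] realizes the equality case of Young's
    inequality ([legendre_powR]), for small [x] a [t] proportional to [x / n]
    stays below the threshold [t1] ([tail_regimes]).

    The conditioning is made rigorous without conditional expectations: the
    pair formed by the past and the next innovation has a product law on
    [Omega * Y], where [Omega] carries the sigma-algebra of the past, and
    Fubini's theorem applies ([ge0_integral_independent]). The joint
    measurability this demands comes from the separability of the state space
    ([measurable_lipschitz]). *)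

(** * Lipschitz functions on separable metric spaces *)

Section borel_metric.
Context {R : realType}.

Lemma open_mball (T : completeMetricType R) (a : T) (r : R) :
  open [set y : T | mdist a y < r].
Proof.
rewrite openE => x /= axr; apply/nbhs_ballP.
exists (r - mdist a x) => /=; first by rewrite subr_gt0.
move=> y; rewrite ballEmdist/= => xy.
by rewrite (le_lt_trans (metric_triangle a x y))// -ltrBrDl.
Qed.

Lemma measurable_mdist (T : completeMetricType R) (a : T) :
  measurable_fun setT (mdist a : borel T -> R).
Proof.
apply: (measurability _ (RGenInftyO.measurableE R)) => //.
move=> _ [_ [x ->] <-]; rewrite setTI; apply: sub_sigma_algebra.
rewrite [X in open X](_ : _ = [set y : T | mdist a y < x]);
  first exact: open_mball.
by apply/seteqP; split => y /=; rewrite in_itv.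
Qed.

Lemma separable_seq (T : completeMetricType R) : separable T ->
  exists e : nat -> T, forall (x : T) (r : R), 0 < r -> exists i, mdist x (e i) < r.
Proof.
move=> [D cD dD].
have D_dense (x : T) (r : R) : 0 < r -> exists2 y, D y & mdist x y < r.
  move=> r0; have [| | y []] := dD [set y : T | mdist x y < r].
  - by exists x; rewrite /= mdistxx.
  - exact: open_mball.
  - by move=> /= ? ?; exists y.
have [x Dx _] := D_dense point 1 ltr01.
have /pfcard_geP [D0|[f]] := cD; first by rewrite D0 in Dx.
exists f => y r /(D_dense y)[z Dz yz].
by have [i _ fi] := 'surj_f Dz; exists i; rewrite fi.
Qed.

(** As in McShane's extension formula, [f] is the infimum over [z] of the cones
    [f z + L * \sum_i mdist (z i) (_ i)]; by separability countably many apexes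
    [z] suffice, so that the sublevel sets of [f] are countable unions of
    measurable sets. *)
Lemma measurable_lipschitz (T : completeMetricType R) d (Z : measurableType d)
    (n : nat) (L : R) (f : (nat -> T) -> R) (W : nat -> Z -> borel T) :
  separable T -> 0 < L ->
  (forall x x', `|f x - f x'| <= L * \sum_(i < n) mdist (x i) (x' i)) ->
  (forall i, (i < n)%N -> measurable_fun setT (W i)) ->
  measurable_fun setT (fun w => f (fun i => W i w)).
Proof.
move=> sT L0 fL mW.
have [e e_dense] := separable_seq sT.
(* The apexes are the finite sequences of points of [e], coded by integers. *)
pose z k i := e (nth 0%N (odflt [::] (unpickle k : option (seq nat))) i).
pose cone k w := f (z k) + L * \sum_(i < n) mdist (z k i) (W i w).
have mcone k : measurable_fun setT (cone k).
  apply: measurable_funD => //; apply: measurable_funM => //.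
  apply: measurable_sum => i; apply: measurableT_comp (mW i (ltn_ord i)).
  exact: measurable_mdist.
apply: (measurability _ (RGenInftyO.measurableE R)) => //.
move=> _ [_ [r ->] <-]; rewrite setTI.
rewrite (_ : _ @^-1` _ = \bigcup_k (cone k @^-1` `]-oo, r[)).
  apply: bigcupT_measurable => k; rewrite -[X in measurable X]setTI.
  exact: mcone.
apply/seteqP; split => [w|w [k _]]; rewrite /= !in_itv/=; last first.
  apply: le_lt_trans; rewrite -lerBlDl.
  rewrite (le_trans (ler_norm _))// (le_trans (fL _ _))//.
  by under eq_bigr do rewrite metric_sym.
set x := fun i => W i w => fxr.
(* Both [f (z k)] and the distance term of the cone exceed their values at [x]
   by at most [L * n * delta]. *)
pose delta := (r - f x) / (2 * L * n.+1%:R).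
have delta0 : 0 < delta by rewrite divr_gt0 ?subr_gt0// !mulr_gt0.
have /choice[s xs] : forall i, exists j, mdist (x i) (e j) < delta.
  by move=> i; exact: e_dense.
pose k := pickle (mkseq s n).
exists k => //=; rewrite in_itv/=.
have zx (i : 'I_n) : mdist (z k i) (x i) <= delta.
  by rewrite /z pickleK/= nth_mkseq// metric_sym ltW.
have dist_le : L * \sum_(i < n) mdist (z k i) (x i) <= L * (n%:R * delta).
  rewrite ler_pM2l// (le_trans (ler_sum _ (fun i _ => zx i)))//.
  by rewrite sumr_const card_ord mulr_natl.
have fz : f (z k) <= f x + L * \sum_(i < n) mdist (z k i) (x i).
  by rewrite -lerBlDl (le_trans (ler_norm _)).
have -> : r = f x + 2 * (L * (n.+1%:R * delta)).
  by rewrite /delta; field; rewrite gt_eqF//= lt0r_neq0.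
have : L * (n%:R * delta) < L * (n.+1%:R * delta).
  by rewrite ltr_pM2l// ltr_pM2r// ltr_nat.
by rewrite /cone -/x; lra.
Qed.

Lemma mdist_lipschitz (T U : completeMetricType R) (C : R) (u v : U -> T) :
  (forall y y', mdist (u y) (u y') <= C * mdist y y') ->
  (forall y y', mdist (v y) (v y') <= C * mdist y y') ->
  forall y y', `|mdist (u y) (v y) - mdist (u y') (v y')| <= 2 * C * mdist y y'.
Proof.
move=> uC vC y y'.
have h1 := metric_triangle (u y) (u y') (v y).
have h2 := metric_triangle (u y') (v y') (v y).
have h3 := metric_triangle (u y') (u y) (v y').
have h4 := metric_triangle (u y) (v y) (v y').
have := uC y y'; have := vC y y'.
rewrite (metric_sym (u y') (u y)) in h3; rewrite (metric_sym (v y') (v y)) in h2.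
by rewrite ler_norml; lra.
Qed.

Lemma measurable_lipschitz1 (T : completeMetricType R) (L : R) (g : T -> R) :
  separable T -> 0 < L -> (forall x y, `|g x - g y| <= L * mdist x y) ->
  measurable_fun setT (g : borel T -> R).
Proof.
move=> sT L0 gL.
apply: (@measurable_lipschitz T _ (borel T) 1 L (fun x => g (x 0%N)) (fun=> id)) => //.
by move=> x x'; rewrite big_ord1.
Qed.

Lemma measurable_mdist_lipschitz (T U : completeMetricType R) (C : R) (u v : U -> T) :
  separable U -> 0 < C ->
  (forall y y', mdist (u y) (u y') <= C * mdist y y') ->
  (forall y y', mdist (v y) (v y') <= C * mdist y y') ->
  measurable_fun setT ((fun y => mdist (u y) (v y)) : borel U -> R).
Proof.
move=> sU C0 uC vC; apply: (@measurable_lipschitz1 _ (2 * C)) => //.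
  by rewrite mulr_gt0.
exact: mdist_lipschitz.
Qed.

End borel_metric.

(** * Independence and Fubini's theorem *)

Section independence_fubini.
Context {d : measure_display} {Omega : measurableType d} {R : realType}.
Variable P : probability Omega R.

(** Independence of a fixed event [E] extends from a pi-system to the
    sigma-algebra it generates, as the events independent of [E] form a
    lambda-system. *)
Lemma independent_generated (G : set (set Omega)) (E : set Omega) :
  G `<=` measurable -> setI_closed G -> measurable E ->
  (forall A, G A -> P (A `&` E) = (P A * P E)%E) ->
  forall A, <<s G >> A -> P (A `&` E) = (P A * P E)%E.
Proof.
move=> Gm GI mE GE.
have sGm : <<s G >> `<=` measurable.
  by apply: smallest_sub => //; exact: sigma_algebra_measurable.
apply: (@dynkin_induction _ (g_sigma_algebraType G) G
  (fun A => P (A `&` E) = (P A * P E)%E)) => //.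
- by rewrite setTI probability_setT mul1e.
- move=> S /sGm mS PS.
  rewrite (_ : ~` S `&` E = E `\` (S `&` E)); last first.
    by rewrite setDE setCI setIUr setICr setU0 setIC.
  rewrite measureD//; [|exact: measurableI|by rewrite -ge0_fin_numE// fin_num_measure].
  rewrite (_ : E `&` _ = S `&` E); last by rewrite setICA setIid.
  rewrite [X in (_ - X)%E](_ : _ = (P S * P E)%E)//.
  rewrite probability_setC//.
  rewrite muleBl ?mul1e//.
  by rewrite fin_num_measure.
- move=> F mF tF PF; rewrite setI_bigcupl.
  have {}mF k : measurable (F k : set Omega) by apply: sGm; exact: mF.
  rewrite !measure_bigcup//; last 2 first.
  + by move=> k _; exact: measurableI.
  + exact: trivIset_setIr.
  rewrite muleC -[P E]fineK ?fin_num_measure// -nneseriesZl//.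
  by apply: eq_eseriesr => k _; rewrite fineK ?fin_num_measure// muleC; exact: PF.
Qed.

Context {d1 d2 : measure_display} {Z : measurableType d1} {Y : measurableType d2}.
Variables (W : Omega -> Z) (eps : Omega -> Y) (nu : probability Y R).
Hypotheses (mW : measurable_fun setT W) (meps : measurable_fun setT eps).
Hypothesis indep : forall A B, measurable A -> measurable B ->
  P (W @^-1` A `&` eps @^-1` B) = (P (W @^-1` A) * nu B)%E.

(* The product law is all that independence provides: the joint law of
   [(W, eps)] and the product measure agree on rectangles. *)
Let W_rv : {RV P >-> Z} := HB.pack W (isMeasurableFun.Build _ _ _ _ W mW).

Let mpair : measurable_fun setT (fun w => (W w, eps w)).
Proof. exact: measurable_fun_pair. Qed.

Let pair_rv : {RV P >-> (Z * Y)%type} :=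
  HB.pack (fun w => (W w, eps w)) (isMeasurableFun.Build _ _ _ _ _ mpair).

Let joint_law A : measurable A ->
  (distribution P W_rv \x nu)%E A = distribution P pair_rv A.
Proof.
apply: product_measure_unique => A' B mA mB.
by rewrite /distribution /pushforward/= -indep.
Qed.

(** Conditioning on [W]: the inner integral is the conditional expectation of
    [h (W, eps)] given [W]. *)
Lemma ge0_integral_independent (h : Z * Y -> \bar R) :
  measurable_fun setT h -> (forall z, (0 <= h z)%E) ->
  (\int[P]_w h (W w, eps w) = \int[P]_w \int[nu]_y h (W w, y))%E.
Proof.
move=> mh h0.
rewrite -(@ge0_integral_distribution _ _ _ _ _ P pair_rv h)//.
rewrite -(eq_measure_integral _ (fun A mA _ => joint_law mA)).
rewrite fubini_tonelli1//.
rewrite (@ge0_integral_distribution _ _ _ _ _ P W_rv)//.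
  exact: measurable_fun_fubini_tonelli_F.
by move=> z; exact: integral_ge0.
Qed.

Lemma integral_independent (h : Z * Y -> \bar R) :
  measurable_fun setT h -> P.-integrable setT (fun w => h (W w, eps w)) ->
  (\int[P]_w h (W w, eps w) = \int[P]_w \int[nu]_y h (W w, y))%E.
Proof.
move=> mh ih.
rewrite -(@integral_distribution _ _ _ _ _ P pair_rv h)//.
rewrite -(eq_measure_integral _ (fun A mA _ => joint_law mA)).
have ihp : (distribution P W_rv \x nu)%E.-integrable setT h.
  apply/integrableP; split => //.
  rewrite (eq_measure_integral _ (fun A mA _ => joint_law mA)).
  rewrite (@ge0_integral_distribution _ _ _ _ _ P pair_rv)//.
    by case/integrableP : ih.
  exact: measurableT_comp.
rewrite -integral12_prod_meas1//.
have iF := integrable_fubini_F ihp.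
rewrite (@integral_distribution _ _ _ _ _ P W_rv)//.
  exact: (measurable_fubini_F ihp).
apply/integrableP; split.
  by apply: measurableT_comp => //; exact: (measurable_fubini_F ihp).
case/integrableP : iF => _.
rewrite (@ge0_integral_distribution _ _ _ _ _ P W_rv)//.
by apply: measurableT_comp => //; exact: (measurable_fubini_F ihp).
Qed.

End independence_fubini.

(** * Laplace transforms of centered functions *)

Section laplace.
Context {R : realType}.

Lemma expR_le_taylor1 (x : R) : expR x <= 1 + x + x ^+ 2 * expR `|x|.
Proof.
have expR_sub1 (y : R) : expR y - 1 <= y * expR y.
  have := ler_wpM2r (expR_ge0 y) (expR_ge1Dx (- y)).
  by rewrite -expRD addNr expR0; lra.
have expx := expR_sub1 x; have := expR_ge1Dx x.
case: (lerP 0 x) => x0.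
  rewrite ger0_norm// => _.
  have : x * (expR x - 1) <= x * (x * expR x) by exact: ler_wpM2l.
  by rewrite expr2; lra.
have e1 : 1 <= expR `|x| by rewrite -[leLHS]expR0 ler_expR.
move=> h; have : x * (expR x - 1) <= x * x by rewrite ler_nM2l//; lra.
have : x ^+ 2 * 1 <= x ^+ 2 * expR `|x| by rewrite ler_wpM2l// sqr_ge0.
by rewrite expr2; lra.
Qed.

(** Since [D ^+ 2 <= expR (2 * `|D|)], the quadratic remainder costs only a
    shift by 2 of the parameter of the exponential moment of [H]. *)
Lemma expR_le_centered (t t0 D H : R) : 0 <= t <= t0 -> `|D| <= H ->
  expR (t * D) <= 1 + t * D + t ^+ 2 * expR ((t0 + 2) * H).
Proof.
move=> /andP[t_ge0 tt0] DH; apply: le_trans (expR_le_taylor1 _) _.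
rewrite lerD2l exprMn -mulrA ler_wpM2l ?sqr_ge0//.
have D2 : D ^+ 2 <= expR (2 * `|D|).
  rewrite mulrDl mul1r expRD -expr2 -[D ^+ 2]real_normK ?num_real// lerXn2r ?nnegrE ?expR_ge0//.
  by apply: le_trans (expR_ge1Dx _); rewrite lerDr.
apply: (le_trans (ler_wpM2r (expR_ge0 _) D2)).
rewrite -expRD ler_expR normrM (ger0_norm t_ge0).
have := normr_ge0 D; move: (`|D|) DH => N NH N0.
have : t * N <= t0 * N by exact: ler_wpM2r.
have : (t0 + 2) * N <= (t0 + 2) * H by rewrite ler_wpM2l//; lra.
lra.
Qed.

Context {d : measure_display} {T : measurableType d}.
Variable mu : probability T R.

Lemma integrable_of_le_ge0 (f g : T -> R) (N : R) :
  measurable_fun setT f -> measurable_fun setT g -> (forall x, 0 <= g x) ->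
  (forall x, `|f x| <= g x) -> (\int[mu]_x (g x)%:E <= N%:E)%E ->
  mu.-integrable setT (EFin \o f).
Proof.
move=> mf mg g0 fg gN; apply/integrableP; split; first exact/measurable_EFinP.
apply: (@le_lt_trans _ _ (\int[mu]_x (g x)%:E)%E).
  apply: ge0_le_integral => //.
  - by do 2 apply: measurableT_comp => //.
  - exact/measurable_EFinP.
  - by move=> x _; rewrite /= lee_fin.
exact: le_lt_trans gN (ltry _).
Qed.

(** The linear term of the second-order bound integrates to zero, which leaves
    [1 + N * t ^+ 2]. *)
Lemma laplace_centered (D H : T -> R) (t t0 N : R) :
  measurable_fun setT D -> measurable_fun setT H ->
  mu.-integrable setT (EFin \o D) -> \int[mu]_x D x = 0 ->
  (forall x, `|D x| <= H x) -> 
  (\int[mu]_x (expR ((t0 + 2) * H x))%:E <= N%:E)%E ->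
  0 <= t <= t0 ->
  (\int[mu]_x (expR (t * D x))%:E <= (expR (N * t ^+ 2))%:E)%E.
Proof.
move=> mD mH iD D0 DH HN tt0.
pose e x := expR ((t0 + 2) * H x).
have me : measurable_fun setT e.
  by apply: measurableT_comp => //; exact: measurable_funM.
have ie : mu.-integrable setT (EFin \o e).
  apply: (integrable_of_le_ge0 me me) HN => x; first exact: expR_ge0.
  by rewrite ger0_norm// expR_ge0.
have i1 : mu.-integrable setT (EFin \o cst (1:R)).
  exact: finite_measure_integrable_cst.
have itD : mu.-integrable setT (EFin \o (fun x => t * D x)).
  by apply: (@eq_integrable _ _ _ _ _ measurableT _ _ _ (integrableZl _ t iD)).
have ite : mu.-integrable setT (EFin \o (fun x => t ^+ 2 * e x)).
  by apply: (@eq_integrable _ _ _ _ _ measurableT _ _ _ (integrableZl _ (t ^+ 2) ie)).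
apply: (@le_trans _ _ (\int[mu]_x (1 + t * D x + t ^+ 2 * e x)%:E)%E).
  apply: ge0_le_integral => //.
  - by apply/measurable_EFinP; apply: measurableT_comp => //; exact: measurable_funM.
  - apply/measurable_EFinP; apply: measurable_funD; last exact: measurable_funM.
    by apply: measurable_funD => //; exact: measurable_funM.
  - by move=> x _; rewrite lee_fin; exact: expR_le_centered.
have i1tD : mu.-integrable setT (EFin \o (fun x => 1 + t * D x)).
  by apply: (@eq_integrable _ _ _ _ _ measurableT _ _ _ (integrableD measurableT i1 itD)).
rewrite -[leLHS]fineK; last first.
  apply: integrable_fin_num => //.
  by apply: (@eq_integrable _ _ _ _ _ measurableT _ _ _ (integrableD measurableT i1tD ite)).
rewrite lee_fin -/(Rintegral _ _ _) !RintegralD// !RintegralZl// D0 mulr0 addr0.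
have -> : \int[mu]_x 1 = 1 :> R.
  by rewrite Rintegral_cst// mul1r; exact: (congr1 fine (probability_setT mu)).
apply: le_trans (expR_ge1Dx _); rewrite lerD2l mulrC ler_wpM2r ?sqr_ge0//.
by rewrite -lee_fin /Rintegral fineK//; exact: integrable_fin_num ie.
Qed.

End laplace.

(** * Lipschitz functions of one variable *)

Section lipschitz_laplace.
Context {R : realType}.

(** Young's inequality for the product of [(p * a) `^ p^-1 * G] and
    [(q * tau) `^ q^-1 * t]. *)
Lemma young_exponents (p q a tau c t G : R) : 0 < p -> 0 < q ->
  p^-1 + q^-1 = 1 -> 0 <= a -> 0 <= tau ->
  c = (q * tau) `^ q^-1 * (p * a) `^ p^-1 -> 0 <= t -> 0 <= G ->
  t * (c * G) <= tau * t `^ q + a * G `^ p.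
Proof.
move=> p0 q0 pq a0 tau0 -> t0 G0.
have qtau0 : 0 <= q * tau by rewrite mulr_ge0// ltW.
have pa0 : 0 <= p * a by rewrite mulr_ge0// ltW.
have -> : t * ((q * tau) `^ q^-1 * (p * a) `^ p^-1 * G) =
  ((p * a) `^ p^-1 * G) * ((q * tau) `^ q^-1 * t) by ring.
apply: le_trans (conjugate_powR _ _ p0 q0 pq) _; rewrite ?mulr_ge0 ?powR_ge0//.
rewrite (powRM p (powR_ge0 _ _) G0) (powRM q (powR_ge0 _ _) t0) -!powRrM !mulVf ?gt_eqF// !powRr1//.
rewrite addrC le_eqVlt; apply/orP; left; apply/eqP.
by field; rewrite !gt_eqF.
Qed.

Context {T : completeMetricType R} (mu : probability (borel T) R).
Hypothesis sT : separable T.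
Hypothesis moment1 : forall x : T, mu.-integrable setT (fun y => (mdist x y)%:E).

Lemma integrable_mdistZ (L : R) (x : T) :
  mu.-integrable setT (EFin \o (fun y : borel T => L * mdist x y)).
Proof.
by apply: (@eq_integrable _ _ _ _ _ measurableT _ _ _ (integrableZl _ L (moment1 x))).
Qed.

Lemma integrable_lipschitz (L : R) (g : T -> R) : 0 < L ->
  (forall x y, `|g x - g y| <= L * mdist x y) ->
  mu.-integrable setT (EFin \o (g : borel T -> R)).
Proof.
move=> L0 gL; pose x0 : T := point.
have i0 : mu.-integrable setT (EFin \o (fun y : borel T => `|g x0| + L * mdist x0 y)).
  have ic := finite_measure_integrable_cst mu `|g x0|%R (@measurableT _ (borel T)).
  by apply: (@eq_integrable _ _ _ _ _ measurableT _ _ _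
    (integrableD measurableT ic (integrable_mdistZ L x0))).
apply: (le_integrable measurableT _ _ i0).
  by apply/measurable_EFinP; exact: measurable_lipschitz1 sT _ gL.
move=> y _; rewrite /= lee_fin [leRHS]ger0_norm ?addr_ge0 ?mulr_ge0 ?mdist_ge0 ?(ltW L0)//.
have := gL x0 y; have := ler_normB (g x0) (g x0 - g y).
by rewrite subKr; lra.
Qed.

(** The mean is itself an average of values of [g], so that the deviation of
    [g x] from it is an average of [g x - g y]. *)
Lemma lipschitz_deviation (L : R) (g : T -> R) (x : T) : 0 < L ->
  (forall x y, `|g x - g y| <= L * mdist x y) ->
  `|g x - \int[mu]_y g y| <= \int[mu]_y (L * mdist x y).
Proof.
move=> L0 gL.
have ig := integrable_lipschitz L0 gL.
have ix := finite_measure_integrable_cst mu (g x) (@measurableT _ (borel T)).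
have igx : mu.-integrable setT (EFin \o (fun y : borel T => g x - g y)).
  by apply: (@eq_integrable _ _ _ _ _ measurableT _ _ _ (integrableB measurableT ix ig)).
have {1}-> : g x = \int[mu]_y g x.
  rewrite Rintegral_cst// -[LHS]mulr1; congr (_ * _).
  exact: esym (congr1 fine (probability_setT mu)).
rewrite -RintegralB//; apply: le_trans (le_normr_Rintegral _ igx) _ => //.
apply: le_Rintegral => //; last exact: integrable_mdistZ.
by apply: integrable_norm.
Qed.

Lemma Rintegral_mdist_lipschitz (L : R) (x x' : T) : 0 < L ->
  `|\int[mu]_y (L * mdist x y) - \int[mu]_y (L * mdist x' y)| <= L * mdist x x'.
Proof.
move=> L0.
rewrite -RintegralB//; [|exact: integrable_mdistZ..].
have i : mu.-integrable setT (EFin \o (fun y : borel T => L * mdist x y - L * mdist x' y)).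
  by apply: (@eq_integrable _ _ _ _ _ measurableT _ _ _
    (integrableB measurableT (integrable_mdistZ L x) (integrable_mdistZ L x'))).
apply: le_trans (le_normr_Rintegral _ i) _ => //.
have -> : L * mdist x x' = \int[mu]_y (L * mdist x x').
  rewrite Rintegral_cst// -[LHS]mulr1; congr (_ * _).
  exact: esym (congr1 fine (probability_setT mu)).
apply: le_Rintegral => //.
- exact: integrable_norm.
- exact: finite_measure_integrable_cst.
- move=> y _; rewrite -mulrBr normrM gtr0_norm// ler_pM2l//.
  have := metric_triangle x x' y; have := metric_triangle x' x y.
  by rewrite (metric_sym x' x) ler_norml => *; lra.
Qed.

Lemma measurable_Rintegral_mdist (L : R) : 0 < L ->
  measurable_fun setT ((fun x => \int[mu]_y (L * mdist x y)) : borel T -> R).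
Proof.
move=> L0; apply: (measurable_lipschitz1 sT L0) => x x'.
exact: Rintegral_mdist_lipschitz.
Qed.

Variables (p q a tau c C K : R).
Hypotheses (p0 : 0 < p) (q0 : 0 < q) (pq : p^-1 + q^-1 = 1) (a0 : 0 <= a).
Hypotheses (tau0 : 0 <= tau) (c0 : 0 < c) (C0 : 0 < C).
Hypothesis cE : c = (q * tau) `^ q^-1 * (p * a) `^ p^-1.
Let G x : R := \int[mu]_y (C * mdist x y).
Hypothesis exp_moment : (\int[mu]_x (expR (a * G x `^ p))%:E <= K%:E)%E.

Let mG : measurable_fun setT (G : borel T -> R).
Proof. exact: measurable_Rintegral_mdist. Qed.

Let G_ge0 x : 0 <= G x.
Proof. by apply: Rintegral_ge0 => y _; rewrite mulr_ge0 ?mdist_ge0// ltW. Qed.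

Let laplace_G t : 0 <= t ->
  (\int[mu]_x (expR (t * (c * G x)))%:E <= (K * expR (tau * t `^ q))%:E)%E.
Proof.
move=> t0.
have mGp : measurable_fun setT (fun x : borel T => expR (a * G x `^ p)).
  apply: measurableT_comp => //; apply: measurable_funM => //.
  exact: (measurableT_comp (measurable_powR p)  mG).
apply: (@le_trans _ _ (\int[mu]_x ((expR (tau * t `^ q))%:E * (expR (a * G x `^ p))%:E))%E).
  apply: ge0_le_integral => //.
  - apply/measurable_EFinP; apply: measurableT_comp => //.
    by do 2 apply: measurable_funM => //.
  - by apply: emeasurable_funM => //; apply/measurable_EFinP.
  - by move=> x _; rewrite -EFinM lee_fin -expRD ler_expR; exact: young_exponents.
rewrite ge0_integralZl ?lee_fin ?expR_ge0//; last exact/measurable_EFinP.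
by rewrite EFinM muleC lee_wpmul2r// lee_fin expR_ge0.
Qed.

Variable g : T -> R.
Hypothesis gL : forall x y, `|g x - g y| <= c * C * mdist x y.
Let m := \int[mu]_y g y.

Let cC0 : 0 < c * C. Proof. exact: mulr_gt0. Qed.

Let deviation x : `|g x - m| <= c * G x.
Proof.
apply: (le_trans (lipschitz_deviation x cC0 gL)).
rewrite /G -RintegralZl//; last exact: integrable_mdistZ.
by under eq_Rintegral do rewrite -mulrA.
Qed.

Let mg : measurable_fun setT (g : borel T -> R).
Proof. exact: measurable_lipschitz1 sT _ gL. Qed.

Lemma laplace_lipschitz_large t : 0 <= t ->
  (\int[mu]_x (expR (t * (g x - m)))%:E <= (K * expR (tau * t `^ q))%:E)%E.
Proof.
move=> t0; apply: le_trans (laplace_G t0).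
apply: ge0_le_integral => //.
- apply/measurable_EFinP; apply: measurableT_comp => //; apply: measurable_funM => //.
  exact: measurable_funB.
- apply/measurable_EFinP; apply: measurableT_comp => //.
  by do 2 apply: measurable_funM => //.
- move=> x _; rewrite lee_fin ler_expR ler_wpM2l//.
  exact: le_trans (ler_norm _) (deviation x).
Qed.

Lemma laplace_lipschitz_small t t0 : 0 <= t <= t0 ->
  (\int[mu]_x (expR (t * (g x - m)))%:E <=
   (expR (K * expR (tau * (t0 + 2) `^ q) * t ^+ 2))%:E)%E.
Proof.
move=> tt0; have t02 : 0 <= t0 + 2 by case/andP: tt0; lra.
have ig := integrable_lipschitz cC0 gL.
have im := finite_measure_integrable_cst mu m (@measurableT _ (borel T)).
apply: (@laplace_centered _ _ _ mu _ (fun x => c * G x) t t0) => //.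
- exact: measurable_funB.
- exact: measurable_funM.
- by apply: (@eq_integrable _ _ _ _ _ measurableT _ _ _ (integrableB measurableT ig im)).
- rewrite RintegralB// Rintegral_cst//.
  have -> : fine (mu [set: borel T]) = 1 by exact: (congr1 fine (probability_setT mu)).
  by rewrite mulr1 subrr.
- exact: laplace_G.
Qed.

End lipschitz_laplace.

Section exponential_moment.
Context {R : realType} {d : measure_display} {Omega : measurableType d}.
Context {P : probability Omega R} {T : completeMetricType R}.
Variables (Z : {RV P >-> borel T}) (a p C K : R).
Hypotheses (a0 : 0 < a) (p0 : 0 < p) (C0 : 0 < C).
Hypothesis exp_moment :
  (\int[P]_w expeR (a%:E * poweR (mean_dist C Z (Z w)) p) <= K%:E)%E.

Let integrable_of_mean_dist x : (mean_dist C Z x < +oo)%E ->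
  (distribution P Z).-integrable setT (EFin \o (fun y : borel T => C * mdist x y)).
Proof.
move=> xoo; apply/integrableP; split.
  apply/measurable_EFinP; apply: measurable_funM => //; exact: measurable_mdist.
rewrite (le_lt_trans _ xoo)// /mean_dist.
rewrite le_eqVlt; apply/orP; left; apply/eqP; apply: eq_integral => y _ /=.
by rewrite ger0_norm// mulr_ge0 ?mdist_ge0// ltW.
Qed.

(** Were [mean_dist] infinite everywhere, so would be the exponential moment;
    finiteness at one point spreads to all by the triangle inequality. *)
Lemma exponential_moment_integrable_mdist (x : T) :
  (distribution P Z).-integrable setT (fun y => (mdist x y)%:E).
Proof.
have [x0 /integrable_of_mean_dist ix0] : exists x0, (mean_dist C Z x0 < +oo)%E.
  apply: contrapT => /forallNP noo; move: exp_moment.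
  rewrite leNgt => /negP; apply.
  rewrite (eq_integral (cst +oo%E)); last first.
    move=> w _; have /negP := noo (Z w); rewrite -leNgt leye_eq => /eqP ->.
    by rewrite poweRyr ?gt_eqF// gt0_muley ?lte_fin.
  rewrite integral_cst// [X in (_ * X)%E](_ : _ = 1%E) ?mule1 ?ltry//.
  exact: probability_setT.
have i1 : (distribution P Z).-integrable setT
    (EFin \o (fun y : borel T => mdist x x0 + C^-1 * (C * mdist x0 y))).
  have ic := finite_measure_integrable_cst (distribution P Z) (mdist x x0)
    (@measurableT _ (borel T)).
  by apply: (@eq_integrable _ _ _ _ _ measurableT _ _ _
    (integrableD measurableT ic (integrableZl _ C^-1 ix0))).
apply: (le_integrable measurableT _ _ i1).
  by apply/measurable_EFinP; exact: measurable_mdist.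
move=> y _; rewrite /= lee_fin mulKf ?gt_eqF// !ger0_norm ?addr_ge0 ?mdist_ge0//.
exact: metric_triangle.
Qed.

Lemma exponential_moment_distribution : separable T ->
  (\int[distribution P Z]_x
     (expR (a * (\int[distribution P Z]_y (C * mdist x y)) `^ p))%:E <= K%:E)%E.
Proof.
move=> sT.
have im := exponential_moment_integrable_mdist.
have mG : measurable_fun setT
    ((fun x => \int[distribution P Z]_y (C * mdist x y)) : borel T -> R).
  exact: measurable_Rintegral_mdist.
rewrite (@ge0_integral_distribution _ _ _ _ _ P Z); last 2 first.
- apply/measurable_EFinP; apply: measurableT_comp => //.
  apply: measurable_funM => //; exact: (measurableT_comp (measurable_powR p) mG).
- by move=> y; rewrite lee_fin expR_ge0.
apply: le_trans exp_moment; rewrite le_eqVlt; apply/orP; left; apply/eqP.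
apply: eq_integral => w _ /=.
have -> : mean_dist C Z (Z w) = (\int[distribution P Z]_y (C * mdist (Z w : T) y))%:E.
  by rewrite /Rintegral fineK//; apply: integrable_fin_num => //; exact: integrable_mdistZ.
by rewrite poweR_EFin -EFinM.
Qed.

End exponential_moment.

(** * The past of the chain *)

Section chain_history.
Context {R : realType} {X Y : completeMetricType R}.
Context {d : measure_display} {Omega : measurableType d} {P : probability Omega R}.
Variables (X1 : {RV P >-> borel X}) (eps : nat -> {RV P >-> borel Y}).
Variable F : (borel X * borel Y)%type -> borel X.
Hypothesis mF : measurable_fun setT F.

(** A pi-system generating the sigma-algebra of the past
    [X1, eps 1, ..., eps n]. Putting this sigma-algebra on [Omega] itself avoids
    a product space whose number of factors depends on [n]. *)
Definition history_sets (n : nat) : set (set Omega) :=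
  [set E | exists A (B : nat -> set (borel Y)), [/\ measurable A,
    forall i, measurable (B i) &
    E = X1 @^-1` A `&` \big[setI/setT]_(i <- iota 1 n) (eps i @^-1` B i)]].

Let chn (i : nat) (w : Omega) : borel X := chain F X1 (fun k => eps k) i w.

Let measurable_rv {d'} {T : measurableType d'} (Z : {RV P >-> T}) A :
  measurable A -> measurable (Z @^-1` A).
Proof. by move=> mA; rewrite -[X in measurable X]setTI; exact: measurable_funP. Qed.

Lemma history_sets_measurable n : history_sets n `<=` measurable.
Proof.
move=> _ [A [B [mA mB ->]]]; apply: measurableI; first exact: measurable_rv.
by apply: bigsetI_measurable => i _; exact: measurable_rv.
Qed.

Lemma history_sets_setI_closed n : setI_closed (history_sets n).
Proof.
move=> _ _ [A [B [mA mB ->]]] [A' [B' [mA' mB' ->]]].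
exists (A `&` A'), (fun i => B i `&` B' i); split.
- exact: measurableI.
- by move=> i; exact: measurableI.
- by rewrite setIACA -big_split/= preimage_setI.
Qed.

Lemma measurable_chain_history n i : (i <= n)%N ->
  measurable_fun setT (chn i : g_sigma_algebraType (history_sets n) -> borel X).
Proof.
elim: i => [_|i IH lt_in].
  move=> _ A mA; rewrite setTI; apply: sub_sigma_algebra.
  exists A, (fun=> setT); split => //.
  by rewrite big1_seq ?setIT// => *; rewrite preimage_setT.
pose step (w : g_sigma_algebraType (history_sets n)) := (chn i w, eps i.+1 w).
suff mstep : measurable_fun setT step by exact: (measurableT_comp mF mstep).
apply: measurable_fun_pair.
  exact: IH (ltnW lt_in).
move=> _ B mB; rewrite setTI; apply: sub_sigma_algebra.
exists setT, (fun j => if j == i.+1 then B else setT); split => //.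
  by move=> j; case: ifP.
rewrite preimage_setT setTI (bigD1_seq i.+1)/= ?iota_uniq//; last first.
  by rewrite mem_iota/= add1n.
rewrite eqxx big1 ?setIT// => j /negPf ->; exact: preimage_setT.
Qed.

Variable nu : probability (borel Y) R.
Hypothesis eps_law : forall k B, measurable B -> P (eps k @^-1` B) = nu B.
Hypothesis eps_indep : mutually_independent eps.
Hypothesis X1_indep : independent_of_family [set i | (1 <= i)%N] X1 eps.

(** On the generating pi-system this combines the independence of [X1] from
    the innovations with their mutual independence. *)
Lemma history_independent n (E : set Omega) (B : set (borel Y)) :
  <<s history_sets n >> E -> measurable B ->
  P (E `&` eps n.+1 @^-1` B) = (P E * nu B)%E.
Proof.
move=> sE mB; rewrite -(eps_law n.+1 mB).
apply: (independent_generated (@history_sets_measurable n)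
  (@history_sets_setI_closed n)) => //; first exact: measurable_rv.
move=> _ [A [B' [mA mB' ->]]].
have sigma_eps (s : seq nat) (D : nat -> set (borel Y)) :
    (forall i, i \in s -> (1 <= i)%N) -> (forall i, measurable (D i)) ->
    sigma_family [set i | (1 <= i)%N] eps (\big[setI/setT]_(i <- s) (eps i @^-1` D i)).
  move=> s1 mD; rewrite big_seq.
  apply: (@bigsetI_measurable _ (g_sigma_algebraType
    (\bigcup_(i in [set i | (1 <= i)%N]) preimage_set_system setT (eps i) measurable))).
  move=> i /s1 i1; apply: sub_sigma_algebra; exists i => //.
  by exists (D i) => //; rewrite setTI.
pose D i := if i == n.+1 then B else B' i.
have mD i : measurable (D i) by rewrite /D; case: ifP.
have past : \big[setI/setT]_(i <- iota 1 n) (eps i @^-1` B' i) =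
            \big[setI/setT]_(i <- iota 1 n) (eps i @^-1` D i).
  apply: eq_big_seq => i; rewrite mem_iota add1n ltnS => /andP[_ i_n].
  by rewrite /D ltn_eqF.
have all : \big[setI/setT]_(i <- iota 1 n) (eps i @^-1` D i) `&` eps n.+1 @^-1` B =
           \big[setI/setT]_(i <- n.+1 :: iota 1 n) (eps i @^-1` D i).
  by rewrite big_cons /D eqxx setIC.
rewrite past -setIA all.
rewrite X1_indep//; last by apply: sigma_eps => // i; rewrite mem_iota => /andP[].
rewrite X1_indep//; last first.
  by apply: sigma_eps => // i; rewrite inE => /predU1P[->//|]; rewrite mem_iota => /andP[].
rewrite (eps_indep _ mD); last by rewrite /= iota_uniq mem_iota add1n ltnn andbF.
rewrite (eps_indep _ mD); last exact: iota_uniq.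
have -> : P (eps n.+1 @^-1` B) = P (eps n.+1 @^-1` D n.+1) by rewrite /D eqxx.
by rewrite big_cons (muleC (P (eps n.+1 @^-1` _))) muleA.
Qed.

End chain_history.

(** * Laplace transform of a Lipschitz function of the chain *)

Section chain_laplace.
Context {R : realType} {X Y : completeMetricType R}.
Context {d : measure_display} {Omega : measurableType d} {P : probability Omega R}.
Variables (X1 : {RV P >-> borel X}) (eps : nat -> {RV P >-> borel Y}).
Variable F : (borel X * borel Y)%type -> borel X.
Variable nu : probability (borel Y) R.
Variables rho c C : R.
Hypotheses (sX : separable X) (sY : separable Y).
Hypothesis mF : measurable_fun setT F.
Hypothesis eps_law : forall k B, measurable B -> P (eps k @^-1` B) = nu B.
Hypothesis eps_indep : mutually_independent eps.
Hypothesis X1_indep : independent_of_family [set i | (1 <= i)%N] X1 eps.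
Hypotheses (C0 : 0 < C) (c1 : 1 <= c) (c_rho : 1 + c * rho <= c).
Hypothesis contraction : forall x x' : X,
  (\int[nu]_y (mdist (F (x, y) : X) (F (x', y) : X))%:E <= (rho * mdist x x')%:E)%E.
Hypothesis F_lip : forall (x : X) (y y' : Y),
  mdist (F (x, y) : X) (F (x, y') : X) <= C * mdist y y'.
Hypothesis nu_moment1 : forall y : Y, nu.-integrable setT (fun y' => (mdist y y')%:E).
Hypothesis X1_moment1 : forall x : X,
  (distribution P X1).-integrable setT (fun x' => (mdist x x')%:E).

(** The class of functions of the coordinates [0, ..., n] that is stable under
    integration of the last innovation; working with functions of whole
    sequences lets [n] vary without dependent types. *)
Definition last_lipschitz (n : nat) (f : (nat -> X) -> R) : Prop :=
  forall x x', `|f x - f x'| <=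
    \sum_(i < n) mdist (x i) (x' i) + c * mdist (x n) (x' n).

Definition set_coord (x : nat -> X) (k : nat) (v : X) : nat -> X :=
  fun i => if i == k then v else x i.

(** The conditional expectation of [f] given the first [n.+1] states. *)
Definition integrate_last (n : nat) (f : (nat -> X) -> R) (x : nat -> X) : R :=
  \int[nu]_y f (set_coord x n.+1 (F (x n, y))).

Let c0 : 0 < c. Proof. exact: lt_le_trans ltr01 c1. Qed.

Let set_coord_eq x k v : set_coord x k v k = v.
Proof. by rewrite /set_coord eqxx. Qed.

Lemma set_coord_lipschitz n f (x x' : nat -> X) (v v' : X) :
  last_lipschitz n.+1 f ->
  `|f (set_coord x n.+1 v) - f (set_coord x' n.+1 v')| <=
  \sum_(i < n.+1) mdist (x i) (x' i) + c * mdist v v'.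
Proof.
move=> /(_ (set_coord x n.+1 v) (set_coord x' n.+1 v')).
rewrite !set_coord_eq => /le_trans; apply; rewrite lerD2r.
by apply: ler_sum => i _; rewrite /set_coord ltn_eqF// ltnS.
Qed.

(** The noise enters through [F], which multiplies distances by at most [C]. *)
Lemma innovation_lipschitz n f x : last_lipschitz n.+1 f -> forall y y',
  `|f (set_coord x n.+1 (F (x n, y))) - f (set_coord x n.+1 (F (x n, y')))|
  <= c * C * mdist y y'.
Proof.
move=> fL y y'; apply: (le_trans (set_coord_lipschitz _ _ _ _ fL)).
rewrite big1 ?add0r; last by move=> i _; rewrite mdistxx.
by rewrite -mulrA ler_pM2l.
Qed.

Let integrable_innovation n f x : last_lipschitz n.+1 f ->
  nu.-integrable setT (EFin \o (fun y : borel Y => f (set_coord x n.+1 (F (x n, y))))).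
Proof.
move=> fL.
by apply: (integrable_lipschitz sY nu_moment1 (mulr_gt0 c0 C0));
  exact: innovation_lipschitz.
Qed.

(** One step of the chain costs [rho]: the constant [c] reproduces itself since
    [1 + c * rho <= c]. *)
Lemma integrate_last_lipschitz n f : last_lipschitz n.+1 f ->
  last_lipschitz n (integrate_last n f).
Proof.
move=> fL x x'; rewrite /integrate_last -RintegralB//; [|exact: integrable_innovation..].
set g := fun y : borel Y => _ - _.
have ig : nu.-integrable setT (EFin \o g).
  by apply: (@eq_integrable _ _ _ _ _ measurableT _ _ _
    (integrableB measurableT (integrable_innovation x fL) (integrable_innovation x' fL))).
apply: le_trans (le_normr_Rintegral _ ig) _ => //.
set S := \sum_(i < n) _.
pose dF (y : borel Y) := mdist (F (x n, y) : X) (F (x' n, y) : X).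
have mdF : measurable_fun setT dF by exact: measurable_mdist_lipschitz C0 _ _.
have idF : nu.-integrable setT (EFin \o dF).
  apply: (@integrable_of_le_ge0 _ _ _ nu dF dF _ mdF mdF _ _ (contraction (x n) (x' n))).
    by move=> y; exact: mdist_ge0.
  by move=> y; rewrite ger0_norm ?mdist_ge0.
have icdF : nu.-integrable setT (EFin \o (fun y => c * dF y)).
  by apply: (@eq_integrable _ _ _ _ _ measurableT _ _ _ (integrableZl _ c idF)).
have icst : nu.-integrable setT (EFin \o (fun=> S + mdist (x n) (x' n))).
  exact: finite_measure_integrable_cst.
apply: (@le_trans _ _ (\int[nu]_y ((S + mdist (x n) (x' n)) + c * dF y))).
  apply: le_Rintegral => //.
  - exact: integrable_norm.
  - by apply: (@eq_integrable _ _ _ _ _ measurableT _ _ _ (integrableD measurableT icst icdF)).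
  - move=> y _; apply: le_trans (set_coord_lipschitz _ _ _ _ fL) _.
    by rewrite big_ord_recr.
rewrite RintegralD// RintegralZl// Rintegral_cst//.
have -> : fine (nu [set: borel Y]) = 1 by exact: (congr1 fine (probability_setT nu)).
rewrite mulr1 -addrA lerD2l.
have : c * \int[nu]_y dF y <= c * (rho * mdist (x n) (x' n)).
  rewrite ler_pM2l// -lee_fin /Rintegral fineK; first exact: contraction.
  exact: integrable_fin_num idF.
have := ler_wpM2r (mdist_ge0 (x n) (x' n)) c_rho.
by rewrite /dF; lra.
Qed.

Let path (w : Omega) : nat -> X := fun i => chain F X1 (fun k => eps k) i w.

Let path_succ n w :
  set_coord (path w) n.+1 (F (path w n, eps n.+1 w)) = path w.
Proof. by apply/funext => i; rewrite /set_coord; case: eqP => [->|]. Qed.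

Let measurable_innovation n f : last_lipschitz n.+1 f ->
  measurable_fun setT (fun z : g_sigma_algebraType (history_sets X1 eps n) * borel Y =>
    f (set_coord (path z.1) n.+1 (F (path z.1 n, z.2)))).
Proof.
move=> fL.
have mpath i : (i <= n)%N -> measurable_fun setT
    (fun z : g_sigma_algebraType (history_sets X1 eps n) * borel Y => path z.1 i : borel X).
  move=> i_n; apply: measurableT_comp measurable_fst.
  exact: measurable_chain_history.
pose W i (z : g_sigma_algebraType (history_sets X1 eps n) * borel Y) : borel X :=
  set_coord (path z.1) n.+1 (F (path z.1 n, z.2)) i.
apply: (measurable_lipschitz (n := n.+2) (f := f) (W := W) sX c0).
- move=> x x'; apply: (le_trans (fL x x')).
  rewrite [X in _ <= c * X]big_ord_recr/= mulrDr lerD2r.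
  by rewrite ler_peMl// sumr_ge0// => i _; exact: mdist_ge0.
- move=> i; rewrite ltnS leq_eqVlt /W /set_coord => /predU1P[->|]; last first.
    by rewrite ltnS => i_n; rewrite ltn_eqF ?ltnS//; exact: mpath.
  rewrite eqxx; pose step (z : g_sigma_algebraType (history_sets X1 eps n) * borel Y) :=
    (path z.1 n : borel X, z.2).
  suff mstep : measurable_fun setT step by exact: (measurableT_comp mF mstep).
  by apply: measurable_fun_pair => //; exact: mpath.
Qed.

Let measurable_id_history n :
  measurable_fun setT (idfun : Omega -> g_sigma_algebraType (history_sets X1 eps n)).
Proof.
move=> _ A sA; rewrite setTI preimage_id.
have : <<s history_sets X1 eps n >> `<=` measurable.
  apply: smallest_sub; first exact: sigma_algebra_measurable.
  exact: history_sets_measurable.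
exact.
Qed.

Let innovation_independent n (A : set (g_sigma_algebraType (history_sets X1 eps n)))
    (B : set (borel Y)) : measurable A -> measurable B ->
  P ((idfun : Omega -> g_sigma_algebraType (history_sets X1 eps n)) @^-1` A
     `&` eps n.+1 @^-1` B) = (P (idfun @^-1` A) * nu B)%E.
Proof. by move=> mA mB; exact: (history_independent eps_law eps_indep X1_indep). Qed.

Let measurable_eps k : measurable_fun setT (eps k : Omega -> borel Y).
Proof. exact: measurable_funP. Qed.

Let ge0_integral_innovation n f (phi : R -> \bar R) : last_lipschitz n.+1 f ->
  measurable_fun setT phi -> (forall r, (0 <= phi r)%E) ->
  (\int[P]_w phi (f (path w)) =
   \int[P]_w \int[nu]_y phi (f (set_coord (path w) n.+1 (F (path w n, y)))))%E.
Proof.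
move=> fL mphi phi0.
under eq_integral do rewrite -(path_succ n).
have mh := measurableT_comp mphi (measurable_innovation fL).
exact: (ge0_integral_independent (@measurable_id_history n) (@measurable_eps n.+1)
  (@innovation_independent n) mh (fun=> phi0 _)).
Qed.

Let integral_innovation n f : last_lipschitz n.+1 f ->
  P.-integrable setT (fun w => (f (path w))%:E) ->
  (\int[P]_w (f (path w))%:E = \int[P]_w (integrate_last n f (path w))%:E)%E.
Proof.
move=> fL ifp.
under eq_integral do rewrite -(path_succ n).
have /measurable_EFinP mh := measurable_innovation fL.
rewrite (integral_independent (@measurable_id_history n) (@measurable_eps n.+1)
  (@innovation_independent n) mh); last first.
  by apply: (@eq_integrable _ _ _ _ _ measurableT _ _ _ ifp) => w _ /=; rewrite path_succ.
apply: eq_integral => w _; rewrite /integrate_last /Rintegral fineK//.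
by apply: integrable_fin_num => //; exact: integrable_innovation.
Qed.

Let measurable_path n f : last_lipschitz n f -> measurable_fun setT (fun w => f (path w)).
Proof.
move=> fL.
apply: (measurable_lipschitz (n := n.+1) (f := f) (W := fun i w => path w i : borel X) sX c0).
- move=> x x'; apply: (le_trans (fL x x')).
  rewrite [X in _ <= c * X]big_ord_recr/= mulrDr lerD2r.
  by rewrite ler_peMl// sumr_ge0// => i _; exact: mdist_ge0.
- move=> i; rewrite ltnS => i_n.
  apply: measurableT_comp (@measurable_id_history n); exact: measurable_chain_history.
Qed.

Let measurable_inner n f (phi : R -> \bar R) : last_lipschitz n.+1 f ->
  measurable_fun setT phi -> (forall r, (0 <= phi r)%E) ->
  measurable_fun setT
    (fun w => \int[nu]_y phi (f (set_coord (path w) n.+1 (F (path w n, y)))))%E.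
Proof.
move=> fL mphi phi0.
have mh := measurableT_comp mphi (measurable_innovation fL).
have mI := measurable_fun_fubini_tonelli_F (m2 := nu) _ mh (fun=> phi0 _).
exact: (measurableT_comp mI (@measurable_id_history n)).
Qed.

Let first_coord f w : last_lipschitz 0 f -> f (path w) = f (fun=> X1 w).
Proof.
move=> fL; apply/eqP; rewrite -subr_eq0 -normr_le0 (le_trans (fL _ _))//.
by rewrite big_ord0 add0r /path/= mdistxx mulr0.
Qed.

Let first_lipschitz f : last_lipschitz 0 f ->
  forall x x' : X, `|f (fun=> x) - f (fun=> x')| <= c * mdist x x'.
Proof. by move=> fL x x'; rewrite (le_trans (fL _ _))// big_ord0 add0r. Qed.

(** By induction, averaging over the last innovation: [f] stays within
    [\int[nu]_y' (c * C * mdist y y')] of its conditional expectation, a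
    quantity that is integrable in [y]. *)
Lemma integrable_chain n f : last_lipschitz n f ->
  P.-integrable setT (fun w => (f (path w))%:E).
Proof.
elim: n f => [f fL|n IH f fL].
  under eq_fun do rewrite first_coord//.
  have ig := integrable_lipschitz sX X1_moment1 c0 (first_lipschitz fL).
  have /measurable_EFinP mg := measurable_lipschitz1 sX c0 (first_lipschitz fL).
  apply/integrableP; split; first exact: (measurableT_comp mg (@measurable_funP _ _ _ _ _ X1)).
  case/integrableP : ig => _.
  by rewrite (@ge0_integral_distribution _ _ _ _ _ P X1)//; exact: measurableT_comp.
apply/integrableP; split; first by apply/measurable_EFinP; exact: measurable_path.
have cC0 : 0 < c * C by rewrite mulr_gt0.
(* [D] bounds the increment uniformly in the past. *)
pose D (y : Y) := \int[nu]_y' (c * C * mdist y y').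
have mD : measurable_fun setT (D : borel Y -> R) by exact: measurable_Rintegral_mdist.
have iD : nu.-integrable setT (EFin \o (D : borel Y -> R)).
  apply: (integrable_lipschitz sY nu_moment1 cC0).
  by move=> y y'; exact: Rintegral_mdist_lipschitz.
pose B := \int[nu]_y D y.
have BE : (\int[nu]_y (D y)%:E)%E = B%:E.
  by rewrite /B /Rintegral fineK//; exact: integrable_fin_num.
pose phi (r : R) : \bar R := `|r|%:E.
have mphi : measurable_fun setT phi by apply/measurable_EFinP; exact: normr_measurable.
have phi0 r : (0 <= phi r)%E by rewrite lee_fin.
rewrite (ge0_integral_innovation fL mphi phi0).
have iB : P.-integrable setT
    (EFin \o (fun w => B + `|integrate_last n f (path w)|)).
  have ic := finite_measure_integrable_cst P B (@measurableT _ Omega).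
  have il := integrable_norm (IH _ (integrate_last_lipschitz fL)).
  by apply: (@eq_integrable _ _ _ _ _ measurableT _ _ _ (integrableD measurableT ic il)).
have B0 : 0 <= B.
  apply: Rintegral_ge0 => y _; apply: Rintegral_ge0 => y' _.
  by rewrite mulr_ge0 ?mdist_ge0// ltW.
case/integrableP : iB => miB; apply: le_lt_trans.
apply: ge0_le_integral => //.
- by move=> w _; exact: integral_ge0.
- exact: measurable_inner.
- exact: measurableT_comp.
move=> w _; rewrite /= ger0_norm ?addr_ge0//.
apply: (@le_trans _ _ (\int[nu]_y ((D y)%:E + `|integrate_last n f (path w)|%:E))%E).
  have ig := integrable_innovation (path w) fL.
  apply: ge0_le_integral => //.
  - by apply: (measurableT_comp mphi); case/integrableP : ig => /measurable_EFinP.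
  - by apply: emeasurable_funD => //; exact/measurable_EFinP.
  - move=> y _; rewrite /phi -EFinD lee_fin.
    have := lipschitz_deviation sY nu_moment1 y cC0 (innovation_lipschitz (path w) fL).
    rewrite -/(D y) -/(integrate_last n f (path w)).
    set u := f _; set v := integrate_last _ _ _ => uv.
    by have := ler_normD (u - v) v; rewrite subrK; lra.
rewrite ge0_integralD//; first last.
- exact/measurable_EFinP.
- by move=> y _; rewrite lee_fin; apply: Rintegral_ge0 => y' _; rewrite mulr_ge0 ?mdist_ge0// ltW.
rewrite BE integral_cst// [X in (_ * X)%E](_ : _ = 1%E) ?mule1 ?EFinD//.
exact: probability_setT.
Qed.

Variables t M : R.
Hypothesis M0 : 0 <= M.
Hypothesis laplace_eps : forall g : Y -> R,
  (forall y y', `|g y - g y'| <= c * C * mdist y y') ->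
  (\int[nu]_y (expR (t * (g y - \int[nu]_y g y)))%:E <= M%:E)%E.
Hypothesis laplace_X1 : forall g : X -> R,
  (forall x x', `|g x - g x'| <= c * mdist x x') ->
  (\int[distribution P X1]_x (expR (t * (g x - \int[distribution P X1]_x g x)))%:E
   <= M%:E)%E.

(** Every integration of an innovation costs a factor [M] and leaves the mean
    unchanged, so that the induction hypothesis applies to [integrate_last n f]
    with the same centering. *)
Lemma laplace_chain n f : last_lipschitz n f ->
  (\int[P]_w (expR (t * (f (path w) - \int[P]_w f (path w))))%:E <= (M ^+ n.+1)%:E)%E.
Proof.
elim: n f => [f fL|n IH f fL].
  have gL := first_lipschitz fL; rewrite expr1.
  have ig := integrable_lipschitz sX X1_moment1 c0 gL.
  have mg := measurable_lipschitz1 sX c0 gL.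
  apply: le_trans (laplace_X1 gL).
  rewrite (@ge0_integral_distribution _ _ _ _ _ P X1); last 2 first.
  - apply/measurable_EFinP; apply: measurableT_comp => //; apply: measurable_funM => //.
    exact: measurable_funB.
  - by move=> x; rewrite lee_fin expR_ge0.
  rewrite le_eqVlt; apply/orP; left; apply/eqP; apply: eq_integral => w _ /=.
  do 4 f_equal; first exact: first_coord.
  rewrite /Rintegral; congr (- fine _).
  under eq_integral do rewrite first_coord//.
  rewrite -(@integral_distribution _ _ _ _ _ P X1 (fun x => (f (fun=> x))%:E))//.
    exact/measurable_EFinP.
  have := integrable_chain fL; apply: eq_integrable => // w' _ /=.
  by rewrite first_coord.
have mE : \int[P]_w f (path w) = \int[P]_w integrate_last n f (path w).
  by rewrite /Rintegral (integral_innovation fL)//; exact: integrable_chain fL.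
rewrite mE; set m := Rintegral _ _ _.
pose phi (r : R) : \bar R := (expR (t * (r - m)))%:E.
have mphi : measurable_fun setT phi.
  apply/measurable_EFinP; apply: measurableT_comp => //; apply: measurable_funM => //.
  exact: measurable_funB.
have phi0 r : (0 <= phi r)%E by rewrite lee_fin expR_ge0.
rewrite (ge0_integral_innovation fL mphi phi0).
have f'L := integrate_last_lipschitz fL.
have mphi' := measurableT_comp mphi (measurable_path f'L).
apply: (@le_trans _ _ (\int[P]_w (M%:E * phi (integrate_last n f (path w))))%E).
  apply: ge0_le_integral => //.
  - by move=> w _; exact: integral_ge0.
  - exact: measurable_inner.
  - exact: emeasurable_funM.
  - move=> w _; set m' := integrate_last _ _ _.
    have mg := measurable_lipschitz1 sY (mulr_gt0 c0 C0) (innovation_lipschitz (path w) fL).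
    rewrite (eq_integral (fun y => phi m' *
      (expR (t * (f (set_coord (path w) n.+1 (F (path w n, y))) - m')))%:E)%E); last first.
      by move=> y _; rewrite /phi -EFinM -expRD -mulrDr; do 3 f_equal; ring.
    rewrite ge0_integralZl//; last first.
      by apply/measurable_EFinP; apply: measurableT_comp => //;
        apply: measurable_funM => //; exact: measurable_funB.
    rewrite muleC lee_wpmul2r//.
    exact: laplace_eps (innovation_lipschitz (path w) fL).
rewrite ge0_integralZl// exprS EFinM lee_wpmul2l ?lee_fin//.
exact: IH.
Qed.

End chain_laplace.

(** * Tail bounds *)

Section tails.
Context {R : realType}.

(** The Legendre transform of [tau * t `^ q] at [u] is attained at
    [t = p * a * u `^ (p - 1)], the equality case of Young's inequality. *)
Lemma legendre_powR (p q a tau u : R) : 1 < p -> 0 < q -> p^-1 + q^-1 = 1 ->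
  0 < a -> 0 < tau -> (q * tau) `^ q^-1 * (p * a) `^ p^-1 = 1 -> 0 <= u ->
  tau * (p * a * u `^ (p - 1)) `^ q - p * a * u `^ (p - 1) * u = - (a * u `^ p).
Proof.
move=> p1 q0 pq a0 tau0 h u0.
have p0 : 0 < p by exact: lt_trans p1.
have pN0 : p != 0 by rewrite gt_eqF.
have qN0 : q != 0 by rewrite gt_eqF.
have pqE : p + q = p * q.
  by rewrite -[RHS]mulr1 -pq mulrDr (mulrAC p) mulfV // mul1r mulfK // addrC.
have pa0 : 0 < p * a by rewrite mulr_gt0.
have hq : q * tau * (p * a) `^ (q - 1) = 1.
  have := congr1 (fun r => r `^ q) h.
  rewrite powR1 powRM ?powR_ge0// -!powRrM mulVf// powRr1 ?mulr_ge0 ?ltW//.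
  by rewrite (_ : p^-1 * q = q - 1)//; apply: (mulfI pN0); rewrite mulrA mulfV// mul1r; lra.
rewrite powRM ?powR_ge0 ?(ltW pa0)// -powRrM.
rewrite (_ : (p - 1) * q = p); last by rewrite mulrBl mul1r -pqE addrK.
have powS (b r : R) : 0 <= b -> 0 < r -> b `^ (r - 1) * b = b `^ r \/ b = 0.
  rewrite le_eqVlt => /predU1P[<-|b0] _; [by right|left].
  by rewrite -{2}[b](powRr1 (ltW b0)) -powRD ?subrK // (gt_eqF b0) implybT.
have [upE|u00] := powS u p u0 p0; last first.
  by rewrite u00 !powR0 ?gt_eqF// ?subr_gt0// !mulr0; lra.
have [paE|] := powS (p * a) q (ltW pa0) q0; last by move/eqP; rewrite gt_eqF.
rewrite -mulrA upE -paE.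
have -> : tau * ((p * a) `^ (q - 1) * (p * a) * u `^ p) =
  (q * tau * (p * a) `^ (q - 1)) * (q^-1 * (p * a) * u `^ p) by field.
rewrite hq mul1r.
have -> : q^-1 * (p * a) = (p - 1) * a.
  by apply: (mulfI qN0); rewrite !mulrA mulfV// mul1r (mulrC q) mulrBl mul1r -pqE addrK.
by lra.
Qed.

Context {d : measure_display} {Omega : measurableType d} (P : probability Omega R).

Lemma chernoff_laplace (Z : Omega -> R) (t x b : R) : measurable_fun setT Z ->
  0 <= t -> (\int[P]_w (expR (t * Z w))%:E <= (expR b)%:E)%E ->
  (P [set w | (x <= Z w)%R] <= (expR (b - t * x))%:E)%E.
Proof.
move=> mZ t_ge0 Zb.
have mset : measurable [set w | (x <= Z w)%R].
  rewrite (_ : [set _ | _] = Z @^-1` `[x, +oo[).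
    by rewrite -[X in measurable X]setTI; exact: mZ.
  by apply/seteqP; split => w /=; rewrite in_itv/= andbT.
move: t_ge0; rewrite le_eqVlt => /predU1P[t0|t0].
  rewrite -t0 mul0r subr0; apply: le_trans (probability_le1 P mset) _.
  apply: le_trans Zb; rewrite -t0.
  under eq_integral do rewrite mul0r expR0.
  rewrite integral_cst// mul1e le_eqVlt; apply/orP; left; apply/eqP.
  exact: esym (probability_setT P).
pose Zrv : {RV P >-> R} := HB.pack Z (isMeasurableFun.Build _ _ _ _ Z mZ).
apply: le_trans (@chernoff _ _ _ P Zrv t x t0) _.
rewrite expRD EFinM lee_wpmul2r ?lee_fin ?expR_ge0//.
rewrite /mmt_gen_fun unlock; apply: le_trans Zb.
by rewrite le_eqVlt; apply/orP; left; apply/eqP; apply: eq_integral => w _ /=; rewrite mulrC.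
Qed.

End tails.

Section constants.
Context {R : realType}.

(** The multiplicative constant [K] in front of [expR (tau * t `^ q)] is
    absorbed by the gap between [tau] and [tau1] once [t] is large. *)
Lemma absorb_constant (q tau tau1 K t : R) : 1 < q -> tau < tau1 -> 1 <= K ->
  1 + ln K / (tau1 - tau) <= t ->
  K * expR (tau * t `^ q) <= expR (tau1 * t `^ q).
Proof.
move=> q1 tau_lt K1 tt1.
have gap : 0 < tau1 - tau by rewrite subr_gt0.
have K0 : 0 < K by exact: lt_le_trans K1.
have lnK_ge0 : 0 <= ln K / (tau1 - tau) by rewrite divr_ge0 ?ln_ge0// ltW.
have t1 : 1 <= t by lra.
have tq : t <= t `^ q.
  by rewrite -{1}[t](powRr1 (le_trans ler01 t1)) ler_powR// ltW.
have lnKt : ln K <= (tau1 - tau) * t `^ q.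
  by rewrite mulrC -ler_pdivrMr//; lra.
rewrite -{1}[K]lnK ?posrE// -expRD ler_expR; lra.
Qed.

(** The threshold [x1] is the deviation per step whose optimal parameter is
    [t1]. Below it, the quadratic bound is used at [t = s * (x / n)]: the two
    terms of the minimum defining [s] ensure [t <= t1] and make the linear term
    dominate. *)
Lemma tail_regimes (p q a1 tau1 t1 A : R) : 1 < p -> 0 < q -> p^-1 + q^-1 = 1 ->
  0 < a1 -> 0 < tau1 -> (q * tau1) `^ q^-1 * (p * a1) `^ p^-1 = 1 ->
  0 < t1 -> 0 < A ->
  exists x1 B : R, [/\ 0 < x1, 0 < B &
    forall (d : measure_display) (Omega : measurableType d) (P : probability Omega R)
      (n : nat) (Z : Omega -> R), (0 < n)%N -> measurable_fun setT Z ->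
      (forall t, t1 <= t ->
        (\int[P]_w (expR (t * Z w))%:E <= (expR (n%:R * tau1 * t `^ q))%:E)%E) ->
      (forall t, 0 <= t <= t1 ->
        (\int[P]_w (expR (t * Z w))%:E <= (expR (n%:R * A * t ^+ 2))%:E)%E) ->
      (forall x, n%:R * x1 <= x -> (P [set w | (x <= Z w)%R]
        <= (expR (- (a1 * x `^ p / n%:R `^ (p - 1))))%:E)%E) /\
      (forall x, 0 <= x <= n%:R * x1 -> (P [set w | (x <= Z w)%R]
        <= (expR (- (B * x ^+ 2 / n%:R)))%:E)%E)].
Proof.
move=> p1 q0 pq a10 tau10 htau t10 A0.
have p0 : 0 < p by exact: lt_trans p1.
have pa0 : 0 < p * a1 by rewrite mulr_gt0.
have pm1 : 0 < p - 1 by rewrite subr_gt0.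
pose x1 := (t1 / (p * a1)) `^ (p - 1)^-1.
have x10 : 0 < x1 by rewrite powR_gt0// divr_gt0.
pose s := Num.min (t1 / x1) (2 * A)^-1.
have s0 : 0 < s by rewrite lt_min divr_gt0//= invr_gt0 mulr_gt0.
exists x1, (s / 2); split => //; first by rewrite divr_gt0.
move=> d Omega P n Z n0 mZ Zlarge Zsmall.
have nR : 0 < n%:R :> R by rewrite ltr0n.
have nN0 : n%:R != 0 :> R by rewrite gt_eqF.
split => x.
  move=> xlarge.
  pose u := x / n%:R.
  have xu : x = n%:R * u by rewrite /u mulrC divfK.
  have ux1 : x1 <= u by rewrite /u ler_pdivlMr// mulrC.
  have u0 : 0 < u by exact: lt_le_trans ux1.
  clearbody u.
  pose t := p * a1 * u `^ (p - 1).
  have tt1 : t1 <= t.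
    rewrite /t mulrC -ler_pdivrMr//.
    have -> : t1 / (p * a1) = x1 `^ (p - 1).
      by rewrite /x1 -powRrM mulVf ?gt_eqF// powRr1// divr_ge0// ltW.
    by apply: (ge0_ler_powR (ltW pm1)) => //; rewrite nnegrE ltW.
  apply: le_trans (chernoff_laplace x mZ (le_trans (ltW t10) tt1) (Zlarge t tt1)) _.
  rewrite lee_fin ler_expR le_eqVlt; apply/orP; left; apply/eqP.
  have := legendre_powR p1 q0 pq a10 tau10 htau (ltW u0); rewrite -/t => leg.
  have -> : n%:R * tau1 * t `^ q - t * x = n%:R * (tau1 * t `^ q - t * u).
    by rewrite xu; ring.
  rewrite leg xu powRM ?(ltW nR) ?(ltW u0)// mulrN; congr (- _).
  have nS : n%:R `^ p = n%:R `^ (p - 1) * n%:R :> R.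
    by rewrite -{3}[n%:R](powRr1 (ltW nR)) -powRD ?subrK// nN0 implybT.
  rewrite nS; field; apply: lt0r_neq0; exact: powR_gt0.
move=> /andP[x0 xsmall].
pose u := x / n%:R.
have xu : x = n%:R * u by rewrite /u mulrC divfK.
have ux1 : u <= x1 by rewrite /u ler_pdivrMr// mulrC.
have u0 : 0 <= u by rewrite divr_ge0// ltW.
clearbody u.
have sA : s * A <= 2^-1.
  have : s <= (2 * A)^-1 by rewrite ge_min lexx orbT.
  by move=> /(ler_wpM2r (ltW A0)); rewrite invfM -mulrA mulVf ?gt_eqF// mulr1.
have sut : 0 <= s * u <= t1.
  rewrite mulr_ge0 ?(ltW s0)//=.
  apply: (@le_trans _ _ (t1 / x1 * x1)); last by rewrite divfK// gt_eqF.
  apply: ler_pM => //; first exact: ltW.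
  by rewrite ge_min lexx.
have /andP[su0 _] := sut.
apply: le_trans (chernoff_laplace x mZ su0 (Zsmall _ sut)) _.
rewrite lee_fin ler_expR.
have -> : s / 2 * x ^+ 2 / n%:R = n%:R * (s / 2 * u ^+ 2) by rewrite xu; field.
have -> : n%:R * A * (s * u) ^+ 2 - s * u * x =
  n%:R * (s * u ^+ 2 * (s * A - 1)) by rewrite xu; ring.
rewrite -mulrN ler_pM2l//.
have : s * u ^+ 2 * (s * A - 1) <= s * u ^+ 2 * (2^-1 - 1).
  by rewrite ler_wpM2l ?lerB// mulr_ge0 ?sqr_ge0// ltW.
lra.
Qed.

End constants.

(** * Deviation inequalities for the chain *)

Theorem proposition3p3 (R : realType) (p q a rho K1 K2 tau tau1 a1 : R)
  (hp : 1 < p) (hpq : p^-1 + q^-1 = 1)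
  (ha : 0 < a) (hrho0 : 0 <= rho) (hrho1 : rho < 1)
  (hK1 : 1 <= K1) (hK2 : 1 <= K2)
  (htau0 : 0 < tau)
  (htau : (q * tau) `^ (q^-1) * (p * a) `^ (p^-1) * (1 - rho) = 1)
  (htau1 : tau < tau1)
  (ha10 : 0 < a1)
  (ha1 : (q * tau1) `^ (q^-1) * (p * a1) `^ (p^-1) = 1) :
  exists t1 x1 A B : R,
    [/\ 0 < t1, 0 < x1, 0 < A & 0 < B] /\
    forall (X Y : completeMetricType R) (d : measure_display)
      (Omega : measurableType d) (P : probability Omega R)
      (X1 : {RV P >-> borel X}) (eps : nat -> {RV P >-> borel Y})
      (F : (borel X * borel Y)%type -> borel X) (C : R)
      (n : nat) (f : ('I_n -> X) -> R),
    separable X -> separable Y ->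
    mutually_independent eps -> identically_distributed eps ->
    independent_of_family [set i | (1 <= i)%N] X1 eps ->
    measurable_fun setT F ->
    0 < C ->
    (forall x x' : X,
       ('E_P[fun w => mdist (F (x, eps 0%N w) : X) (F (x', eps 0%N w) : X)]
         <= (rho * mdist x x')%:E)%E) ->
    (forall (x : X) (y y' : Y),
       mdist (F (x, y) : X) (F (x, y') : X) <= C * mdist y y') ->
    (\int[P]_w expeR (a%:E * poweR (mean_dist 1 X1 (X1 w)) p) <= K1%:E)%E ->
    (\int[P]_w expeR (a%:E * poweR (mean_dist C (eps 0%N) (eps 0%N w)) p)
       <= K2%:E)%E ->
    (1 <= n)%N -> lipschitz1 f ->
    let S := centered P
      (fun w => f (fun i : 'I_n => chain F X1 (fun k => eps k) i w)) in
    forall s : bool,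
      [/\ forall t : R, t1 <= t ->
            ('E_P[fun w => expR ((-1) ^+ s * t * S w)]
              <= (expR (n%:R * tau1 * t `^ q))%:E)%E,
          forall t : R, 0 <= t <= t1 ->
            ('E_P[fun w => expR ((-1) ^+ s * t * S w)]
              <= (expR (n%:R * A * t ^+ 2))%:E)%E,
          forall x : R, n%:R * x1 <= x ->
            (P [set w | (x <= (-1) ^+ s * S w)%R]
              <= (expR (- (a1 * x `^ p / n%:R `^ (p - 1))))%:E)%E
        & forall x : R, 0 <= x <= n%:R * x1 ->
            (P [set w | (x <= (-1) ^+ s * S w)%R]
              <= (expR (- (B * x ^+ 2 / n%:R)))%:E)%E].
Proof.
have p0 : 0 < p by exact: lt_trans hp.
have qE : q^-1 = 1 - p^-1 by rewrite -hpq addrC addKr.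
have pV1 : p^-1 < 1 by rewrite invf_lt1.
have q0 : 0 < q by rewrite -invr_gt0 qE subr_gt0.
have q1 : 1 < q by rewrite -invf_lt1// qE ltrBlDr ltrDl invr_gt0.
have tau10 : 0 < tau1 by exact: lt_trans htau1.
pose c := (1 - rho)^-1.
have rhoB : 0 < 1 - rho by rewrite subr_gt0.
have c1 : 1 <= c by rewrite invf_ge1//; lra.
have c0 : 0 < c by exact: lt_le_trans c1.
have c_rho : 1 + c * rho <= c.
  rewrite le_eqVlt; apply/orP; left; apply/eqP; rewrite /c; field.
  by rewrite gt_eqF.
have cE : c = (q * tau) `^ q^-1 * (p * a) `^ p^-1.
  by apply: (mulIf (lt0r_neq0 rhoB)); rewrite htau mulVf // lt0r_neq0.
pose K := Num.max K1 K2.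
have K_ge1 : 1 <= K by rewrite le_max hK1.
have K0 : 0 < K by exact: lt_le_trans K_ge1.
pose t1 := 1 + ln K / (tau1 - tau).
have t10 : 0 < t1.
  by rewrite ltr_pwDl// divr_ge0 ?ln_ge0// subr_ge0 ltW.
pose A := K * expR (tau * (t1 + 2) `^ q).
have A0 : 0 < A by rewrite mulr_gt0// expR_gt0.
have [x1 [B [x10 B0 tails]]] := tail_regimes hp q0 hpq ha10 tau10 ha1 t10 A0.
exists t1, x1, A, B; split => //.
move=> X Y d Omega P X1 eps F C [//|n] f sX sY eps_indep eps_id X1_indep mF C0.
move=> contr F_lip exp_X1 exp_eps _ f_lip S s.
pose nu := distribution P (eps 0%N).
have eps_law k D : measurable D -> P (eps k @^-1` D) = nu D.
  by move=> mD; exact: (eps_id k 0%N D mD).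
have momX := exponential_moment_integrable_mdist ha p0 ltr01 exp_X1.
have momY := exponential_moment_integrable_mdist ha p0 C0 exp_eps.
have expX : (\int[distribution P X1]_x
    (expR (a * (\int[distribution P X1]_y (1 * mdist (x : X) y)) `^ p))%:E <= K%:E)%E.
  apply: le_trans (exponential_moment_distribution ha p0 ltr01 exp_X1 sX) _.
  by rewrite lee_fin le_max lexx.
have expY : (\int[nu]_x
    (expR (a * (\int[nu]_y (C * mdist (x : Y) y)) `^ p))%:E <= K%:E)%E.
  apply: le_trans (exponential_moment_distribution ha p0 C0 exp_eps sY) _.
  by rewrite lee_fin le_max lexx orbT.
have contraction (x x' : X) :
    (\int[nu]_y (mdist (F (x, y) : X) (F (x', y) : X))%:E <= (rho * mdist x x')%:E)%E.
  apply: le_trans (contr x x'); rewrite unlock.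
  rewrite (@ge0_integral_distribution _ _ _ _ _ P (eps 0%N))//.
  - by apply/measurable_EFinP; exact: (measurable_mdist_lipschitz sY C0 (F_lip x) (F_lip x')).
  - by move=> y; rewrite lee_fin mdist_ge0.
pose path w : nat -> X := fun i => chain F X1 (fun k => eps k) i w.
pose fn (x : nat -> X) := f (fun i => x i).
(* The sign is carried by the function, as [- f] satisfies the same Lipschitz
   condition as [f]. *)
pose fs (x : nat -> X) := (-1) ^+ s * fn x.
have fnL : last_lipschitz c n fn.
  move=> x x'; apply: (le_trans (f_lip _ _)); rewrite big_ord_recr/= lerD2l.
  by rewrite ler_peMl// mdist_ge0.
have fsL : last_lipschitz c n fs.
  move=> x x'; rewrite /fs -mulrBr normrM normrX normrN1 expr1n mul1r.
  exact: fnL.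
have ifn := integrable_chain sX sY mF eps_law eps_indep X1_indep C0 c1 c_rho
  contraction F_lip momY momX fnL.
have SE w : (-1) ^+ s * S w = fs (path w) - \int[P]_w fs (path w).
  rewrite /S /centered /fs mulrBr RintegralZl//; congr (_ - _ * _).
  by rewrite unlock.
have mS : measurable_fun setT (fun w => (-1) ^+ s * S w).
  under eq_fun do rewrite SE.
  apply: measurable_funB => //; apply: measurable_funM => //.
  by apply/measurable_EFinP; case/integrableP : ifn.
have laplace t M : 0 <= M ->
  (forall g : Y -> R, (forall y y', `|g y - g y'| <= c * C * mdist y y') ->
    (\int[nu]_y (expR (t * (g y - \int[nu]_y g y)))%:E <= M%:E)%E) ->
  (forall g : X -> R, (forall x x', `|g x - g x'| <= c * 1 * mdist x x') ->
    (\int[distribution P X1]_x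
      (expR (t * (g x - \int[distribution P X1]_x g x)))%:E <= M%:E)%E) ->
  (\int[P]_w (expR (t * ((-1) ^+ s * S w)))%:E <= (M ^+ n.+1)%:E)%E.
  move=> M0 lapY lapX; under eq_integral do rewrite SE.
  apply: (laplace_chain sX sY mF eps_law eps_indep X1_indep C0 c1 c_rho
    contraction F_lip momY momX M0 lapY _ fsL).
  by move=> g gL; apply: lapX; rewrite mulr1.
have large t : t1 <= t ->
  (\int[P]_w (expR (t * ((-1) ^+ s * S w)))%:E
    <= (expR (n.+1%:R * tau1 * t `^ q))%:E)%E.
  move=> tt1; have t_ge0 : 0 <= t by rewrite (le_trans _ tt1)// ltW.
  rewrite -mulrA expRM_natl; apply: laplace; first exact: expR_ge0.
  - move=> g gL; apply: (@le_trans _ _ (K * expR (tau * t `^ q))%:E); last first.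
      by rewrite lee_fin; exact: absorb_constant.
    exact: (laplace_lipschitz_large sY momY p0 q0 hpq (ltW ha) (ltW htau0) c0 C0 cE expY gL).
  - move=> g gL; apply: (@le_trans _ _ (K * expR (tau * t `^ q))%:E); last first.
      by rewrite lee_fin; exact: absorb_constant.
    exact: (laplace_lipschitz_large sX momX p0 q0 hpq (ltW ha) (ltW htau0) c0 ltr01 cE expX gL).
have small t : 0 <= t <= t1 ->
  (\int[P]_w (expR (t * ((-1) ^+ s * S w)))%:E
    <= (expR (n.+1%:R * A * t ^+ 2))%:E)%E.
  move=> tt1; rewrite -mulrA expRM_natl; apply: laplace; first exact: expR_ge0.
  - move=> g gL.
    exact: (laplace_lipschitz_small sY momY p0 q0 hpq (ltW ha) (ltW htau0) c0 C0 cE expY gL).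
  - move=> g gL.
    exact: (laplace_lipschitz_small sX momX p0 q0 hpq (ltW ha) (ltW htau0) c0 ltr01 cE expX gL).
have [tail_large tail_small] := tails d Omega P n.+1 _ (ltn0Sn n) mS large small.
have expE t : ('E_P[fun w => expR ((-1) ^+ s * t * S w)] =
    \int[P]_w (expR (t * ((-1) ^+ s * S w)))%:E)%E.
  by rewrite unlock; apply: eq_integral => w _; rewrite (mulrC _ t) mulrA.
split=> [t tt1|t tt1|//|//].
- by rewrite expE; exact: large.
- by rewrite expE; exact: small.
Qed.
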